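(* Suppose that $X$ is an Archimedean vector lattice admitting a minimal topology $\tau$. Then $\tau$ is metrizable if and only if $X$ has the countable sup property and a countable order basis.
   Context: All vector lattices are assumed Archimedean. A linear topology on a vector lattice is locally solid if it has a base at zero consisting of solid sets. A minimal topology on $X$ is a Hausdorff locally solid topology $\tau$ on $X$ such that there is no strictly coarser Hausdorff locally solid topology on $X$. A topology is metrizable if it is the metric topology of some metric. $X$ has the countable sup property if every non-empty subset of $X$ possessing a supremum contains an at most countable subset with the same supremum. $X$ has a countable order basis if there is an at most countable set $A\subseteq X$ with $B(A)=X$, where $B(A)$ denotes the band generated by $A$. *)

(* Defs.v *)
From HB Require Import structures.
From mathcomp Require Import all_boot all_order all_algebra.
From mathcomp Require Import all_classical all_reals all_analysis.

Set Implicit Arguments.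
Unset Strict Implicit.
Unset Printing Implicit Defensive.

Import Order.TTheory GRing.Theory Num.Theory.
Import numFieldNormedType.Exports.

Local Open Scope classical_set_scope.
Local Open Scope ring_scope.

(* Hierarchy Builder rejects a structure that inherits both [GRing.Lmodule] and
   [Order.Lattice] (the numeric structures of the library already join additive and
   lattice structures without a common ancestor), so the lattice operations are
   given here on top of the partial order. *)
HB.mixin Record POrder_Lmodule_isVectorLattice (R : numDomainType) V
    & GRing.Lmodule R V & Order.POrder ring_display V := {
  vl_leD2r : forall x y z : V, x <= y -> x + z <= y + z ;
  vl_leZ2l : forall (a : R) (x y : V), 0 <= a -> x <= y -> a *: x <= a *: y ;
  vl_join : V -> V -> V ;
  vl_meet : V -> V -> V ;
  vl_leUx : forall x y z : V, (vl_join x y <= z) = (x <= z) && (y <= z) ;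
  vl_lexI : forall x y z : V, (z <= vl_meet x y) = (z <= x) && (z <= y)
}.

#[short(type="vectorLatticeType")]
HB.structure Definition VectorLattice (R : numDomainType) :=
  {V of GRing.Lmodule R V & Order.POrder ring_display V
      & POrder_Lmodule_isVectorLattice R V}.

Section VectorLattices.
Context {R : realType} (X : vectorLatticeType R).

Definition archimedean : Prop :=
  forall x : X, 0 <= x ->
    infimums ([set (n.+1%:R : R)^-1 *: x | n in [set: nat]] : set X) (0 : X).

Definition countable_sup_property : Prop :=
  forall (A : set X) (s : X), A !=set0 -> supremums A s ->
    exists B : set X, [/\ B `<=` A, countable B & supremums B s].

Definition vl_abs (x : X) : X := vl_join x (- x).

Definition solid (A : set X) : Prop :=
  forall x y : X, A y -> vl_abs x <= vl_abs y -> A x.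

Definition order_ideal (I : set X) : Prop :=
  [/\ I 0,
      forall x y : X, I x -> I y -> I (x + y),
      forall (a : R) (x : X), I x -> I (a *: x)
    & solid I].

Definition band (B : set X) : Prop :=
  order_ideal B /\
  forall (D : set X) (s : X), D `<=` B -> supremums D s -> B s.

(* [smallest band A] is the intersection of all bands containing [A]. *)
Definition countable_order_basis : Prop :=
  exists2 A : set X, countable A & smallest band A = [set: X].

End VectorLattices.

(* A topology on the carrier [X] is an inhabitant of the class
   [Topological X], as in [sup_topology]; [topo_space tau] is [X] seen as the
   topological space given by [tau]. *)
Definition topo_space (X : Type) (tau : Topological X) : topologicalType :=
  Topological.Pack tau.

Definition strictly_coarser (X : Type) (sigma tau : Topological X) : Prop :=
  @open (topo_space sigma) `<` @open (topo_space tau).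

Definition metrizable (R : realType) (X : Type) (tau : Topological X) : Prop :=
  exists d : Metric R X, @open (Metric.Pack d) = @open (topo_space tau).

Section LocallySolid.
Context {R : realType} {X : vectorLatticeType R}.
Implicit Type tau : Topological X.

(* The conditions defining [TopologicalLmodule]; continuity of the opposite
   follows from that of the scaling. *)
Definition linear_topology tau : Prop :=
  let T := topo_space tau in
  continuous (fun z : T * T => ((z.1 : X) + (z.2 : X) : T)) /\
  continuous (fun z : R^o * T => (z.1 *: (z.2 : X) : T)).

Definition locally_solid tau : Prop :=
  linear_topology tau /\
  exists2 B : set (set X), B `<=` @solid R X &
    nbhs ((0 : X) : topo_space tau) = filter_from B id.

Definition hausdorff_locally_solid tau : Prop :=
  hausdorff_space (topo_space tau) /\ locally_solid tau.

Definition minimal_topology tau : Prop :=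
  hausdorff_locally_solid tau /\
  ~ exists2 sigma : Topological X,
      hausdorff_locally_solid sigma & strictly_coarser sigma tau.

End LocallySolid.

(* Main.v *)
Require Import Defs.
From HB Require Import structures.
From mathcomp Require Import all_boot all_order all_algebra.
From mathcomp Require Import all_classical all_reals all_analysis.

Set Implicit Arguments.
Unset Strict Implicit.
Unset Printing Implicit Defensive.

Import Order.TTheory GRing.Theory Num.Theory.
Import numFieldNormedType.Exports.

Local Open Scope classical_set_scope.
Local Open Scope ring_scope.

(** Topologies are studied through their bases at zero.  Any filter base B of solid
    sets that absorbs, can be halved and separates points generates a
    Hausdorff locally solid topology (base_locally_solid); if its members are zero
    neighbourhoods of a minimal topology tau, it must generate tau
    (minimal_open_base).  Everything is an application of this principle.

    Applied to the sets {x : |x| /\ u in V}, where u runs over an order dense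
    directed set of positive elements, it shows that tau is unbounded
    (minimal_disj).  A suitable choice of the u's then shows that tau has the
    Lebesgue property: downward directed sets with infimum 0 enter every zero
    neighbourhood (minimal_lebesgue).

    If tau is metrizable, it has a countable base (W_n) at zero.  The Lebesgue
    property extracts from a set with supremum s finite subsets whose joins
    approach s within W_n, and their union is a countable subset with supremum
    s.  Unboundedness gives u_n such that everything disjoint from u_n lies in W_n;
    an element disjoint from all u_n is then 0, so the u_n generate X as a band.

    Conversely, consider the normal sequences of solid zero neighbourhoods
    (V_{n+1} + V_{n+1} in V_n) and their kernels, the intersections of the V_n.  By
    the Lebesgue property kernels are bands, and since tau is Hausdorff, the union of
    their disjoint complements is an order dense ideal, the carrier.  In an
    Archimedean space each element |e| of a countable order basis is then a
    supremum of elements of the carrier, and by the countable sup property of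
    countably many.  Countably many normal sequences can be merged into one, whose
    kernel is therefore disjoint from all of X, that is, zero
    (separating_normal_seq).  This sequence is a countable solid base that
    separates points; by minimality it generates tau, and a Hausdorff uniformity
    with a countable base is metrizable. *)

(** * Arithmetic of vector lattices *)

Section LatticeArithmetic.
Context {R : realType} {X : vectorLatticeType R}.
Implicit Types x y z t : X.

Lemma vl_leD2 x y z : (x + z <= y + z) = (x <= y).
Proof.
apply/idP/idP => [|/vl_leD2r//].
by move=> /(vl_leD2r _ _ (- z)); rewrite !addrK.
Qed.

Lemma vl_leD x y z t : x <= y -> z <= t -> x + z <= y + t.
Proof.
move=> xy zt; apply: (@le_trans _ _ (y + z)); first by rewrite vl_leD2.
by rewrite ![y + _]addrC vl_leD2.
Qed.

Lemma vl_leBlr x y z : (x - z <= y) = (x <= y + z).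
Proof. by rewrite -(vl_leD2 (x - z) y z) subrK. Qed.

Lemma vl_leBrr x y z : (x <= y - z) = (x + z <= y).
Proof. by rewrite -(vl_leD2 x (y - z) z) subrK. Qed.

Lemma vl_subr_ge0 x y : (0 <= x - y) = (y <= x).
Proof. by rewrite vl_leBrr add0r. Qed.

Lemma vl_leN2 x y : (- x <= - y) = (y <= x).
Proof. by rewrite -(vl_subr_ge0 (- y)) opprK addrC vl_subr_ge0. Qed.

Lemma vl_addr_ge0 x y : 0 <= x -> 0 <= y -> 0 <= x + y.
Proof. by move=> x0 y0; rewrite -[0]addr0 vl_leD. Qed.

Lemma vl_lerDl x y : 0 <= y -> x <= x + y.
Proof. by move=> y0; rewrite -{1}[x]addr0 vl_leD. Qed.

Lemma vl_lerDr x y : 0 <= y -> x <= y + x.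
Proof. by move=> y0; rewrite addrC vl_lerDl. Qed.

Lemma vl_lerBl x y : 0 <= y -> x - y <= x.
Proof. by move=> y0; rewrite vl_leBlr vl_lerDl. Qed.

Lemma vl_scale_ge0 (a : R) x : 0 <= a -> 0 <= x -> 0 <= a *: x.
Proof. by move=> a0 x0; rewrite -(scaler0 X a) vl_leZ2l. Qed.

Lemma vl_mulrn_ge0 x n : 0 <= x -> 0 <= x *+ n.
Proof.
by move=> x0; elim: n => [|n IH]; rewrite ?mulr0n// mulrS vl_addr_ge0.
Qed.

Lemma vl_leUl x y : x <= vl_join x y.
Proof. by have := lexx (vl_join x y); rewrite vl_leUx => /andP[]. Qed.

Lemma vl_leUr x y : y <= vl_join x y.
Proof. by have := lexx (vl_join x y); rewrite vl_leUx => /andP[]. Qed.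

Lemma vl_leIl x y : vl_meet x y <= x.
Proof. by have := lexx (vl_meet x y); rewrite vl_lexI => /andP[]. Qed.

Lemma vl_leIr x y : vl_meet x y <= y.
Proof. by have := lexx (vl_meet x y); rewrite vl_lexI => /andP[]. Qed.

Lemma vl_meetC x y : vl_meet x y = vl_meet y x.
Proof. by apply/le_anti/andP; split; rewrite vl_lexI vl_leIl vl_leIr. Qed.

Lemma vl_leI2 x y z t : x <= y -> z <= t -> vl_meet x z <= vl_meet y t.
Proof.
by move=> xy zt; rewrite vl_lexI (le_trans (vl_leIl _ _) xy)
  (le_trans (vl_leIr _ _) zt).
Qed.

Lemma vl_meet_ge0 x y : 0 <= x -> 0 <= y -> 0 <= vl_meet x y.
Proof. by move=> x0 y0; rewrite vl_lexI x0. Qed.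

Lemma vl_meet_idl x y : x <= y -> vl_meet x y = x.
Proof. by move=> xy; apply/le_anti; rewrite vl_leIl vl_lexI lexx xy. Qed.


Lemma vl_leU2 x y z t : x <= y -> z <= t -> vl_join x z <= vl_join y t.
Proof.
by move=> xy zt; rewrite vl_leUx (le_trans xy (vl_leUl _ _))
  (le_trans zt (vl_leUr _ _)).
Qed.

Lemma vl_joinDmeet x y : vl_join x y + vl_meet x y = x + y.
Proof.
apply/le_anti/andP; split.
  rewrite -vl_leBrr vl_leUx !vl_leBrr; apply/andP; split.
    by rewrite [x + y]addrC [x + _]addrC vl_leD2 vl_leIr.
  by rewrite [y + _]addrC vl_leD2 vl_leIl.
rewrite [X in _ <= X]addrC -vl_leBlr vl_lexI; apply/andP; split.
  by rewrite vl_leBlr vl_leD// ?vl_leUr.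
by rewrite vl_leBlr addrC vl_leD// vl_leUl.
Qed.

Definition vl_pos x : X := vl_join x 0.

Lemma vl_pos_ge0 x : 0 <= vl_pos x.
Proof. exact: vl_leUr. Qed.

Lemma vl_le_pos x : x <= vl_pos x.
Proof. exact: vl_leUl. Qed.

Lemma vl_pos_le x y : x <= y -> 0 <= y -> vl_pos x <= y.
Proof. by move=> xy y0; rewrite vl_leUx xy. Qed.

Lemma vl_posBmeet x y : vl_pos (x - y) = x - vl_meet x y.
Proof.
apply/le_anti/andP; split.
  rewrite vl_leUx vl_subr_ge0 vl_leIl andbT.
  by rewrite vl_leBlr addrAC vl_leBrr vl_leD// vl_leIr.
rewrite vl_leBlr addrC -vl_leBlr vl_lexI; apply/andP; split.
  by rewrite vl_lerBl// vl_pos_ge0.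
by rewrite vl_leBlr addrC -vl_leBlr vl_le_pos.
Qed.

Lemma vl_pos_sub x : vl_pos x - vl_pos (- x) = x.
Proof.
have := vl_posBmeet 0 x; rewrite !sub0r => ->.
by rewrite opprK vl_meetC /vl_pos vl_joinDmeet addr0.
Qed.

(** With m the meet, x^- - m is nonnegative and still dominates -x, because
    m <= x^+ = x + x^-; hence it dominates x^-. *)
Lemma vl_pos_disj x : vl_meet (vl_pos x) (vl_pos (- x)) = 0.
Proof.
have E : vl_pos x = x + vl_pos (- x).
  by rewrite -{2}(vl_pos_sub x) subrK.
apply/le_anti/andP; split; last by rewrite vl_meet_ge0 ?vl_pos_ge0.
set m := vl_meet _ _.
have m0 : 0 <= vl_pos (- x) - m by rewrite vl_subr_ge0 vl_leIr.
have m1 : - x <= vl_pos (- x) - m.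
  rewrite vl_leBrr addrC -vl_leBrr opprK addrC -E; exact: vl_leIl.
have := vl_pos_le m1 m0.
by rewrite vl_leBrr addrC -vl_leBrr subrr.
Qed.

Lemma vl_ler_abs x : x <= vl_abs x.
Proof. exact: vl_leUl. Qed.

Lemma vl_absN x : vl_abs (- x) = vl_abs x.
Proof.
by apply/le_anti/andP; split; rewrite /vl_abs vl_leUx ?opprK vl_leUl vl_leUr.
Qed.

Lemma vl_ge0_half x : 0 <= x + x -> 0 <= x.
Proof.
move=> x0; have : 0 <= (2%:R^-1 : R) *: (x + x).
  by rewrite vl_scale_ge0// invr_ge0 ler0n.
by rewrite -[x + x]mulr2n -(scaler_nat 2 x) scalerA mulVf ?scale1r ?pnatr_eq0.
Qed.

Lemma vl_abs_ge0 x : 0 <= vl_abs x.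
Proof.
apply: vl_ge0_half; rewrite -{1}(subrr x).
by rewrite vl_leD ?vl_ler_abs// -vl_absN vl_ler_abs.
Qed.

Lemma vl_ge0_abs x : 0 <= x -> vl_abs x = x.
Proof.
move=> x0; apply/le_anti; rewrite vl_ler_abs vl_leUx lexx /= andbT.
by rewrite (le_trans _ x0)// -oppr0 vl_leN2.
Qed.

Lemma vl_absid x : vl_abs (vl_abs x) = vl_abs x.
Proof. by rewrite vl_ge0_abs ?vl_abs_ge0. Qed.

Lemma vl_abs_le x y : (vl_abs x <= y) = (x <= y) && (- x <= y).
Proof. exact: vl_leUx. Qed.

Lemma vl_abs0 : vl_abs (0 : X) = 0.
Proof. by rewrite vl_ge0_abs. Qed.

Lemma vl_abs_eq0 x : vl_abs x <= 0 -> x = 0.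
Proof.
rewrite vl_abs_le => /andP[x0 x0']; apply/le_anti; rewrite x0/=.
by rewrite -vl_leN2 oppr0.
Qed.

Lemma vl_absD x y : vl_abs (x + y) <= vl_abs x + vl_abs y.
Proof.
by rewrite vl_abs_le opprD !vl_leD ?vl_ler_abs// -1?[vl_abs x]vl_absN
  -1?[vl_abs y]vl_absN vl_ler_abs.
Qed.

Lemma vl_absZ_le (a b : R) x : `|a| <= b -> vl_abs (a *: x) <= b *: vl_abs x.
Proof.
have scaleW c y : c <= b -> 0 <= y -> c *: y <= b *: y.
  by move=> cb y0; rewrite -vl_subr_ge0 -scalerBl vl_scale_ge0// subr_ge0.
move=> ab; apply: le_trans (scaleW _ _ ab (vl_abs_ge0 x)).
have abs0 := normr_ge0 a.
have le1 : `|a| *: x <= `|a| *: vl_abs x by rewrite vl_leZ2l// vl_ler_abs.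
have le2 : - (`|a| *: x) <= `|a| *: vl_abs x.
  by rewrite -scalerN vl_leZ2l// -vl_absN vl_ler_abs.
rewrite vl_abs_le; have [a0|a0] := leP 0 a.
  by move: le1 le2; rewrite ger0_norm// => -> ->.
by move: le1 le2; rewrite ltr0_norm// scaleNr opprK => -> ->.
Qed.

Lemma vl_scale_abs_le (a : R) x : 0 < a -> a *: vl_abs x <= vl_abs (a *: x).
Proof.
move=> a0; have ai0 : 0 <= a^-1 by rewrite invr_ge0 ltW.
have := vl_leZ2l _ _ _ (ltW a0) (@vl_absZ_le a^-1 a^-1 (a *: x) _).
rewrite !scalerA mulVf ?mulfV ?gt_eqF// !scale1r; apply.
by rewrite ger0_norm.
Qed.

Lemma vl_abs_pos_le x : vl_pos x <= vl_abs x.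
Proof. by rewrite vl_pos_le ?vl_ler_abs ?vl_abs_ge0. Qed.

(** If t is the left-hand meet, t - x /\ z is the join of t - x and t - z, and
    each of these is below both y and z. *)
Lemma vl_meetD_le x y z : 0 <= x -> 0 <= y -> 0 <= z ->
  vl_meet (x + y) z <= vl_meet x z + vl_meet y z.
Proof.
move=> x0 y0 z0; set t := vl_meet (x + y) z.
have tx : t <= x + y by exact: vl_leIl.
have tz : t <= z by exact: vl_leIr.
rewrite [X in _ <= X]addrC -vl_leBlr vl_lexI; apply/andP; split.
  rewrite vl_leBlr addrC -vl_leBlr vl_lexI !vl_leBlr tx /=.
  by rewrite (le_trans tz)// vl_lerDl.
by rewrite vl_leBlr (le_trans tz)// vl_lerDl// vl_meet_ge0.
Qed.

Lemma vl_disj_mulrn x y n : 0 <= x -> 0 <= y ->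
  vl_meet x y = 0 -> vl_meet (x *+ n) y = 0.
Proof.
move=> x0 y0 xy; elim: n => [|n IH]; first by rewrite mulr0n vl_meet_idl.
apply/le_anti/andP; split; last by rewrite vl_meet_ge0// vl_mulrn_ge0.
rewrite mulrS (le_trans (vl_meetD_le _ _ _)) ?vl_mulrn_ge0//.
by rewrite xy IH addr0.
Qed.

Lemma vl_disj_join x y : vl_meet x y = 0 -> vl_join x y = x + y.
Proof. by rewrite -(vl_joinDmeet x y) => ->; rewrite addr0. Qed.

Lemma vl_disjS x y z t : 0 <= x -> 0 <= z -> x <= y -> z <= t ->
  vl_meet y t = 0 -> vl_meet x z = 0.
Proof.
move=> x0 z0 xy zt yt; apply/le_anti; rewrite vl_meet_ge0// andbT -yt.
exact: vl_leI2.
Qed.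

End LatticeArithmetic.

(** * Order ideals and disjoint complements *)

Section DisjointComplements.
Context {R : realType} {X : vectorLatticeType R}.
Implicit Types (x y z u v w : X) (C D I : set X).

Lemma solid_le C x y : solid C -> C y -> 0 <= x -> x <= y -> C x.
Proof.
move=> sC Cy x0 xy; apply: (sC _ y) => //.
by rewrite vl_ge0_abs// (le_trans xy (vl_ler_abs _)).
Qed.

(** Multiplication by a scalar a is dominated by the n-fold sum of |x| with
    itself once |a| <= n. *)
Lemma solid_add_ideal I : I 0 -> (forall x y, I x -> I y -> I (x + y)) ->
  solid I -> order_ideal I.
Proof.
move=> I0 addI sI; split => // a x Ix.
have [n an] : exists n, `|a| <= n%:R.
  by exists (Num.truncn `|a|).+1; rewrite ltW// truncnS_gt.
apply: (sI _ (vl_abs x *+ n)).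
  elim: n {an} => [|n IH]; rewrite ?mulr0n// mulrS; apply: addI => //.
  by apply: (sI _ x) => //; rewrite vl_absid.
apply: le_trans (vl_absZ_le x an) _.
by rewrite scaler_nat vl_ler_abs.
Qed.

Definition dcompl C : set X :=
  [set x | forall c, C c -> vl_meet (vl_abs x) (vl_abs c) = 0].

Lemma dcomplS C D : C `<=` D -> dcompl D `<=` dcompl C.
Proof. by move=> CD x xD c /CD /xD. Qed.

Lemma vl_self_disj x : vl_meet (vl_abs x) (vl_abs x) = 0 -> x = 0.
Proof. by rewrite vl_meet_idl// => x0; apply: vl_abs_eq0; rewrite x0. Qed.

Lemma dcompl_disj C x : C x -> dcompl C x -> x = 0.
Proof. by move=> Cx /(_ x Cx)/vl_self_disj. Qed.

Lemma ideal_abs I x : order_ideal I -> I x -> I (vl_abs x).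
Proof. by case=> _ _ _ sI Ix; apply: (sI _ x) => //; rewrite vl_absid. Qed.

Lemma ideal_le I x y : order_ideal I -> I y -> 0 <= x -> x <= y -> I x.
Proof.
by move=> [_ _ _ sI]; exact: solid_le.
Qed.

Lemma dcompl_ideal C : order_ideal (dcompl C).
Proof.
apply: solid_add_ideal.
- by move=> c _; rewrite vl_abs0 vl_meet_idl// vl_abs_ge0.
- move=> x y xC yC c Cc; apply/le_anti.
  rewrite vl_meet_ge0 ?vl_abs_ge0// andbT.
  apply: le_trans (vl_leI2 (vl_absD x y) (lexx _)) _.
  apply: le_trans (vl_meetD_le _ _ _) _; rewrite ?vl_abs_ge0//.
  by rewrite xC// yC// addr0.
- move=> x y yC xy c /yC yc.
  by apply: vl_disjS yc; rewrite ?vl_abs_ge0.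
Qed.

(** Closure under suprema holds because, if s = sup D and w = s^+ /\ |c|,
    then s - w still bounds D: each d^+ is disjoint from w, so
    d^+ + w = d^+ \/ w <= s^+.  Hence w <= 0. *)
Lemma dcompl_band C : band (dcompl C).
Proof.
split; first exact: dcompl_ideal.
have [D0C addC sclC solidC] := dcompl_ideal C.
move=> D s DC [sub slub].
(* The empty set has a supremum when X is trivial. *)
have [[d0 Dd0]|/forallNP D0] := pselect (exists d, D d); last first.
  have lb y : s <= y by apply: slub => d /D0.
  suff -> : s = 0 by [].
  by apply/le_anti; rewrite lb /= -(vl_leD2 _ _ s) add0r lb.
have posC : dcompl C (vl_pos s).
  move=> c Cc; rewrite vl_ge0_abs ?vl_pos_ge0//.
  set w := vl_meet _ _.
  have w0 : 0 <= w by rewrite vl_meet_ge0 ?vl_pos_ge0 ?vl_abs_ge0.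
  apply/le_anti; rewrite w0 andbT.
  have : s <= s - w.
    apply: slub => d Dd; have ds : d <= s by exact: sub.
    have dw : vl_meet (vl_pos d) w = 0.
      apply: (vl_disjS _ _ _ _ (DC d Dd c Cc)); rewrite ?vl_pos_ge0//.
        exact: vl_abs_pos_le.
      exact: vl_leIr.
    have dws : vl_pos d + w <= vl_pos s.
      rewrite -vl_disj_join// vl_leUx vl_leIl andbT.
      by apply: vl_leU2.
    rewrite -(vl_pos_sub d) -{1}(vl_pos_sub s) addrAC vl_leD//.
      by rewrite vl_leBrr.
    by rewrite vl_leN2; apply: vl_leU2; rewrite // vl_leN2.
  by rewrite vl_leBrr addrC -vl_leBrr subrr.
rewrite -(vl_pos_sub s); apply: addC => //.
rewrite -scaleN1r; apply: sclC.
apply: (solidC _ d0); first exact: DC.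
rewrite vl_ge0_abs ?vl_pos_ge0// vl_pos_le ?vl_abs_ge0//.
rewrite (@le_trans _ _ (- d0))// ?vl_leN2; first exact: sub.
by rewrite -vl_absN vl_ler_abs.
Qed.

Lemma archimedean_le0 (arch : archimedean X) x w :
  0 <= x -> (forall n, w *+ n <= x) -> w <= 0.
Proof.
move=> x0 wx; have [_ glb] := arch x x0; apply: glb => _ [n _ <-].
have := @vl_leZ2l _ _ _ _ _ (_ : 0 <= (n.+1%:R : R)^-1) (wx n.+1).
rewrite -(scaler_nat n.+1 w) scalerA mulVf ?scale1r ?pnatr_eq0//; apply.
by rewrite invr_ge0.
Qed.

(** If some upper bound z failed to dominate x, then x - x /\ z would lie in
    I^dd without being disjoint from I, hence would dominate some w > 0 of I;
    the multiples of w would then all stay below x /\ z, contradicting the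
    Archimedean property. *)
Lemma ideal_sup_approx (arch : archimedean X) I x : order_ideal I ->
  0 <= x -> dcompl (dcompl I) x ->
  supremums [set y | [/\ I y, 0 <= y & y <= x]] x.
Proof.
move=> idI x0 xI; split; first by move=> y [].
move=> z zub; set z' := x - vl_meet x z.
have z'0 : 0 <= z' by rewrite vl_subr_ge0 vl_leIl.
have z'x : z' <= x.
  rewrite vl_lerBl// vl_meet_ge0//; apply: zub; split => //.
  by case: idI.
suff z'0' : z' = 0.
  by rewrite -(subrK (vl_meet x z) x) -/z' z'0' add0r vl_leIr.
have z'I : dcompl (dcompl I) z' by apply: (ideal_le (dcompl_ideal _) xI).
apply: (dcompl_disj _ z'I) => b Ib; rewrite (vl_ge0_abs z'0).
set w := vl_meet _ _; have w0 : 0 <= w by rewrite vl_meet_ge0 ?vl_abs_ge0.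
have Iw : I w.
  by apply: (ideal_le idI (ideal_abs idI Ib)); rewrite ?vl_leIr.
have Iwn n : I (w *+ n).
  by rewrite -scaler_nat; case: idI => _ _ + _; apply.
apply/le_anti; rewrite w0 andbT; apply: (archimedean_le0 arch x0).
elim=> [|n IH]; first by rewrite mulr0n.
have wz : w *+ n <= z by apply: zub; split; rewrite ?vl_mulrn_ge0.
rewrite mulrS -(subrK (vl_meet x z) x) -/z' vl_leD// ?vl_leIl//.
by rewrite vl_lexI IH.
Qed.

End DisjointComplements.

(** * The topology generated by a solid base at zero *)

Section SolidBases.
Context {R : realType} {X : vectorLatticeType R}.
Implicit Types (B : set (set X)) (U V W : set X).

(** The filter bases at zero that generate a Hausdorff locally solid topology;
    absorption along the sequence 1/(n+1) is enough for solid sets. *)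
Record solid_base B : Prop := SolidBase {
  base_nonempty : B !=set0 ;
  base_solid : B `<=` @solid R X ;
  base_meet : forall U V, B U -> B V -> exists2 W, B W & W `<=` U `&` V ;
  base_half : forall U, B U ->
    exists2 V, B V & forall x y, V x -> V y -> U (x + y) ;
  base_absorb : forall U x, B U -> exists n, U ((n.+1%:R : R)^-1 *: x) ;
  base_separate : forall x, (forall U, B U -> U x) -> x = 0 }.

Variables (B : set (set X)) (baseB : solid_base B).

Lemma base_center U : B U -> U 0.
Proof.
move=> BU; have [n Un] := base_absorb baseB 0 BU.
by rewrite scaler0 in Un.
Qed.

Lemma base_abs U x y : B U -> U y -> vl_abs x <= vl_abs y -> U x.
Proof. by move=> /(base_solid baseB) sU Uy; exact: sU. Qed.

Lemma base_opp U x : B U -> U x -> U (- x).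
Proof. by move=> BU Ux; apply: (base_abs BU Ux); rewrite vl_absN. Qed.

(** A copy of X that carries the uniformity generated by B, so that X itself
    receives no canonical topology. *)
Definition base_space & solid_base B : Type := X.
Local Notation S := (base_space baseB).

Let ent : set_system (S * S) :=
  filter_from B (fun U => [set p | U ((p.2 : X) - (p.1 : X))]).

Let ent_filter : Filter ent.
Proof.
apply: filter_from_filter; first exact: (base_nonempty baseB).
move=> U V BU BV; have [W BW WUV] := base_meet baseB BU BV.
by exists W => // p /= /WUV [].
Qed.

Let ent_diag A : ent A -> (diagonal `<=` A)%classic.
Proof.
move=> [U BU UA] [x y]; rewrite /diagonal/= => <-; apply: UA.
by rewrite /= subrr; exact: base_center.
Qed.

Let ent_inv A : ent A -> ent (A^-1)%relation.
Proof.
move=> [U BU UA]; exists U => // -[x y] /= Uxy; apply: UA => /=.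
by rewrite -opprB; exact: base_opp.
Qed.

Let ent_split A : ent A -> exists2 E, ent E & ((E \; E)%relation `<=` A)%classic.
Proof.
move=> [U BU UA]; have [V BV VU] := base_half baseB BU.
exists [set p | V ((p.2 : X) - (p.1 : X))]; first by exists V.
move=> [x y] [z /= Vxz Vzy]; apply: UA => /=.
rewrite -(subrK (z : X) (y : X)) -addrA.
exact: VU.
Qed.

HB.instance Definition _ := Choice.on S.
HB.instance Definition _ :=
  isUniform.Build S ent_filter ent_diag ent_inv ent_split.

Lemma base_entourageE : @entourage S = ent.
Proof. by []. Qed.

Lemma nbhs_baseE (x : S) (A : set S) :
  nbhs x A <-> exists2 U, B U & forall y : X, U (y - (x : X)) -> A y.
Proof.
rewrite -nbhs_entourageE; split.
  move=> [E [U BU UE] EA]; exists U => // y Uy; apply: EA; apply/mem_set.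
  exact: UE.
move=> [U BU UA]; exists [set p | U ((p.2 : X) - (p.1 : X))]; first by exists U.
by move=> y /set_mem /UA.
Qed.

Lemma nbhs0_baseE : nbhs ((0 : X) : S) = filter_from B id.
Proof.
apply/seteqP; split=> A.
  by move=> /nbhs_baseE[U BU UA]; exists U => // y Uy; apply: UA; rewrite subr0.
move=> [U BU UA]; apply/nbhs_baseE; exists U => // y; rewrite subr0.
exact: UA.
Qed.

Lemma base_hausdorff : hausdorff_space S.
Proof.
move=> p q pq; apply/esym/eqP; rewrite -subr_eq0; apply/eqP.
apply: (base_separate baseB) => U BU; have [V BV VU] := base_half baseB BU.
have Vp : nbhs p [set y : S | V ((y : X) - (p : X))].
  by apply/nbhs_baseE; exists V.
have Vq : nbhs q [set y : S | V ((y : X) - (q : X))].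
  by apply/nbhs_baseE; exists V.
have [z [/= zp zq]] := pq _ _ Vp Vq.
rewrite -(subrK (z : X) (q : X)) -addrA; apply: VU => //.
by rewrite -opprB; exact: base_opp.
Qed.

Lemma base_scale U (n : nat) : B U ->
  exists2 V, B V & forall (a : R) x, `|a| <= n%:R -> V x -> U (a *: x).
Proof.
move=> BU; suff [V BV VU] : exists2 V, B V & forall x, V x -> U (vl_abs x *+ n).
  exists V => // a x an Vx; apply: (base_abs BU (VU _ Vx)).
  rewrite [X in _ <= X]vl_ge0_abs ?vl_mulrn_ge0 ?vl_abs_ge0//.
  by apply: le_trans (vl_absZ_le x an) _; rewrite scaler_nat.
elim: n U BU => [|n IH] U BU.
  by exists U => // x _; rewrite mulr0n; exact: base_center.
have [V BV VU] := base_half baseB BU; have [W BW WV] := IH _ BV.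
have [W' BW' W'VW] := base_meet baseB BV BW.
exists W' => // x /W'VW[Vx /WV Wx]; rewrite mulrS; apply: VU => //.
by apply: (base_abs BV Vx); rewrite vl_absid.
Qed.

Lemma base_locally_solid :
  hausdorff_locally_solid (Topological.on S : Topological X).
Proof.
split; first exact: base_hausdorff.
split; last by exists B; [exact: base_solid|exact: nbhs0_baseE].
split=> -[a x] A.
  move=> /nbhs_baseE[U BU UA]; have [V BV VU] := base_half baseB BU.
  exists ([set y : S | V ((y : X) - (a : X))], [set y : S | V ((y : X) - (x : X))]).
    by split; apply/nbhs_baseE; exists V.
  move=> [b y] [/= Vb Vy]; apply: UA => /=.
  rewrite opprD addrACA; exact: VU.
move=> /nbhs_baseE[U BU UA]; have [V BV VU] := base_half baseB BU.
have [W BW WV] := base_scale (Num.truncn `|a|).+2 BV.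
have [n Vn] := base_absorb baseB x BV.
exists ([set b : R^o | `|b - a| < n.+1%:R^-1], [set y : S | W ((y : X) - (x : X))]).
  split; last by apply/nbhs_baseE; exists W.
  by apply/nbhs_ballP; exists n.+1%:R^-1 => //= b; rewrite /ball/= distrC.
move=> [b y] [/= ba Wy]; apply: UA => /=.
(* The bound on b controls the first term, that on b - a the second. *)
have -> : b *: (y : X) - a *: (x : X) = b *: ((y : X) - x) + (b - a) *: (x : X).
  by rewrite scalerBr scalerBl addrA subrK.
apply: VU; last first.
  apply: (base_abs BV Vn); apply: le_trans (vl_absZ_le x (ltW ba)) _.
  by rewrite vl_scale_abs_le// invr_gt0.
apply: WV => //; rewrite -(subrK a b).
rewrite (le_trans (ler_normD _ _))// -addn1 natrD addrC lerD//.
  by rewrite ltW// truncnS_gt.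
by rewrite (le_trans (ltW ba))// invf_le1// ler1n.
Qed.

End SolidBases.

(** * Metrizability of countable Hausdorff uniformities *)

Section MetricOfBalls.
Context {R : realType} {T : pseudoMetricType R}.
Hypothesis T_hausdorff : hausdorff_space T.
Hypothesis T_bounded : exists M : R, 0 < M /\ forall x y : T, ball x M y.

Let radii (x y : T) : set R := [set e | 0 < e /\ ball x e y].
Let dist (x y : T) : R := inf (radii x y).

Let radii_lb x y : has_lbound (radii x y).
Proof. by exists 0 => e [/ltW]. Qed.

Let radii_inf x y : has_inf (radii x y).
Proof.
split; last exact: radii_lb.
by have [M [M0 bM]] := T_bounded; exists M.
Qed.

Let dist_le x y e : 0 < e -> ball x e y -> dist x y <= e.
Proof. by move=> e0 xy; apply: ge_inf. Qed.

Let dist_lt x y e : dist x y < e -> ball x e y.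
Proof.
by move=> /(inf_lt (radii_inf x y).1)[r [r0 xy] re]; apply: le_ball xy; exact: ltW.
Qed.

Let dist_ge0 x y : 0 <= dist x y.
Proof. by apply: lb_le_inf => [|e [/ltW//]]; have [] := radii_inf x y. Qed.

Let distxx x : dist x x = 0.
Proof.
apply/eqP; rewrite eq_le dist_ge0 andbT; apply/ler_addgt0Pl => e e0.
by rewrite addr0 dist_le//; exact: ballxx.
Qed.

Let dist_positivity x y : dist x y = 0 -> x = y.
Proof.
move=> xy0; apply: T_hausdorff => A C /nbhs_ballP[e /= e0 eA] /nbhs_singleton Cy.
by exists y; split => //; apply: eA; apply: dist_lt; rewrite xy0.
Qed.

Let dist_sym x y : dist x y = dist y x.
Proof.
by congr inf; apply/seteqP; split => e [e0 /ball_sym].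
Qed.

Let dist_triangle y x z : dist x z <= dist x y + dist y z.
Proof.
apply/ler_addgt0Pl => e e0; have e2 : 0 < e / 2 by rewrite divr_gt0.
have -> : e + (dist x y + dist y z) = (dist x y + e / 2) + (dist y z + e / 2).
  by rewrite addrACA -splitr addrC.
apply: dist_le; first by rewrite addr_gt0// ltr_wpDl.
by apply: (@ball_triangle _ _ y); apply: dist_lt; rewrite ltrDl.
Qed.

Definition dist_space : Type := let _ := T_hausdorff in let _ := T_bounded in T.
HB.instance Definition _ := Choice.on dist_space.
HB.instance Definition _ := isMetric.Build R dist_space
  distxx dist_positivity dist_sym dist_triangle.

Lemma nbhs_dist_space (x : T) : nbhs (x : dist_space) = nbhs x.
Proof.
apply/seteqP; split => A /nbhs_ballP[e /= e0 eA]; apply/nbhs_ballP.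
  exists (e / 2) => [|y /= xy]; first by rewrite /= divr_gt0.
  apply: eA; rewrite ballEmdist /=.
  apply: (@le_lt_trans _ _ (e / 2)).
    by apply: dist_le => //; rewrite divr_gt0.
  by rewrite ltr_pdivrMr// ltr_pMr// ltr1n.
exists e => // y; rewrite ballEmdist /= => xy; apply: eA; exact: dist_lt.
Qed.

(** The infimum of the radii e such that y lies in ball x e is a distance;
    boundedness makes the set of these radii nonempty.  The balls of this
    distance need not be the given ones, but each contains the given ball of
    half the radius and is contained in the given ball of the same radius. *)
Lemma bounded_hausdorff_metrizable : metrizable R (Topological.on T).
Proof.
exists (Metric.on dist_space).
apply/funext => A; rewrite !openE; congr (_ `<=` _).
by apply/funext => x; rewrite /interior nbhs_dist_space.
Qed.

End MetricOfBalls.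

Lemma countable_uniformity_metrizable {R : realType} (T : uniformType) :
  hausdorff_space T -> countable_uniformity T -> metrizable R (Topological.on T).
Proof.
move=> hT cT.
apply: (@bounded_hausdorff_metrizable R (countable_uniform.type cT)) => //.
exists 2; split=> // x y; exact: countable_uniform.countable_uniform_bounded.
Qed.

(** * Zero neighbourhoods of locally solid topologies *)

Section LocallySolid.
Context {R : realType} {X : vectorLatticeType R}.
Variable tau : Topological X.
Hypothesis tau_hls : hausdorff_locally_solid tau.
Implicit Types (x y z u v w : X) (U V W : set X).

Local Notation T := (topo_space tau).
Local Notation nbhs0 := (nbhs ((0 : X) : T)).

Lemma nbhs0_solid U : nbhs0 U -> exists V, [/\ solid V, nbhs0 V & V `<=` U].
Proof.
case: tau_hls => _ [_ [B Bsolid nbhsB]] U0.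
move: (U0); rewrite {1}nbhsB => -[V BV VU]; exists V; split => //.
  exact: Bsolid.
by rewrite nbhsB; exists V.
Qed.

Lemma nbhs0_half U : nbhs0 U ->
  exists V, [/\ solid V, nbhs0 V & forall x y, V x -> V y -> U (x + y)].
Proof.
case: (tau_hls) => _ [[addc _] _] U0.
have := addc ((0 : X) : T, (0 : X) : T) U; rewrite /= addr0 => /(_ U0).
move=> [[V1 V2] [/= V10 V20] V12].
have [V [sV V0 VV]] := nbhs0_solid (filterI V10 V20).
by exists V; split => // x y /VV[V1x _] /VV[_ V2y]; exact: (V12 (x, y)).
Qed.

Lemma nbhs0_absorb U x : nbhs0 U -> exists n, U ((n.+1%:R : R)^-1 *: x).
Proof.
case: (tau_hls) => _ [[_ sclc] _] U0.
have := sclc ((0 : R) : R^o, x : T) U; rewrite /= scale0r => /(_ U0).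
move=> [[A1 A2] [/= /nbhs_ballP[e /= e0 eA] A2x] A12].
pose n := Num.truncn e^-1; exists n.
suff : A1 (n.+1%:R^-1 : R^o).
  by move=> A1n; exact: (A12 (_, x) (conj A1n (@nbhs_singleton T x A2 A2x))).
apply: eA; rewrite /ball/= sub0r normrN ger0_norm ?invr_ge0//.
by rewrite invf_plt ?posrE// truncnS_gt.
Qed.

Lemma nbhs_translate x U : nbhs (x : T) U <-> nbhs0 [set y | U (x + y)].
Proof.
case: (tau_hls) => _ [[addc _] _].
have shift a b A : nbhs ((a + b : X) : T) A -> nbhs (b : T) [set y | A (a + y)].
  move=> abA; have := addc (a : T, b : T) A abA.
  move=> [[A1 A2] [/= A1a A2b] A12]; apply: filterS A2b => y A2y.
  by apply: (A12 (a, y)); split => //; exact: (@nbhs_singleton T).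
split=> [xU|xU]; first by apply: shift; rewrite addr0.
have := @shift (- x) x [set y | U (x + y)]; rewrite addNr => /(_ xU).
by apply: filterS => y /=; rewrite addrA subrr add0r.
Qed.

Lemma nbhs0_separate x : (forall U, nbhs0 U -> U x) -> x = 0.
Proof.
case: (tau_hls) => hT _ x0; apply/esym; apply: (hT (0 : X) x) => A C A0 Cx.
by exists x; split; [exact: x0 | exact: (@nbhs_singleton T)].
Qed.

Lemma solid_nbhs_base : solid_base [set U | solid U /\ nbhs0 U].
Proof.
split.
- by exists setT; split => //; exact: filterT.
- by move=> U [].
- move=> U V [_ U0] [_ V0].
  by have [W [sW W0 WUV]] := nbhs0_solid (filterI U0 V0); exists W.
- move=> U [_ /nbhs0_half[V [sV V0 VU]]]; by exists V.
- by move=> U x [_ /nbhs0_absorb].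
- move=> x Ux; apply: nbhs0_separate => U /nbhs0_solid[V [sV V0 VU]].
  by apply: VU; exact: Ux.
Qed.

Lemma base_coarser B (baseB : solid_base B) : B `<=` nbhs0 ->
  @open (base_space baseB) `<=` @open T.
Proof.
move=> B0 A; rewrite !openE => Ao x /Ao /nbhs_baseE[U BU UA].
apply/nbhs_translate; apply: filterS (B0 _ BU) => y Uy; apply: UA.
by rewrite addrC addKr.
Qed.

End LocallySolid.

(** * Minimal topologies are unbounded *)

Section Minimal.
Context {R : realType} {X : vectorLatticeType R}.
Variable tau : Topological X.
Hypothesis tau_min : minimal_topology tau.
Implicit Types (x y z u v w : X) (U V W J D : set X).

Local Notation T := (topo_space tau).
Local Notation nbhs0 := (nbhs ((0 : X) : T)).

Let tau_hls : hausdorff_locally_solid tau := tau_min.1.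

(** The topology generated by B is Hausdorff, locally solid and coarser than
    tau, so minimality leaves no room between the two. *)
Lemma minimal_open_base B (baseB : solid_base B) : B `<=` nbhs0 ->
  @open (base_space baseB) = @open T.
Proof.
move=> B0; have coarser := @base_coarser _ _ _ tau_hls B baseB B0.
apply/seteqP; split => //; apply: contrapT => finer.
case: tau_min => _; apply.
exists (Topological.on (base_space baseB)); first exact: base_locally_solid.
by split.
Qed.

Lemma minimal_nbhs_base B : solid_base B -> B `<=` nbhs0 ->
  forall U, nbhs0 U -> exists2 V, B V & V `<=` U.
Proof.
move=> baseB B0 U; rewrite nbhsE => -[A [Ao A0] AU].
have : @open (base_space baseB) A by rewrite minimal_open_base.
rewrite openE => /(_ _ A0)/nbhs_baseE[V BV VA].
by exists V => // y Vy; apply/AU/VA; rewrite subr0.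
Qed.

(** A minimal topology is unbounded with respect to every order dense directed
    set J of positive elements: the sets {x : |x| /\ u in V}, with u in J and V
    a zero neighbourhood, generate a coarser Hausdorff locally solid topology,
    hence tau itself.  So every zero neighbourhood contains such a set, and with
    it the disjoint complement of u. *)
Lemma minimal_disj J : J !=set0 -> (forall u, J u -> 0 <= u) ->
  (forall u v, J u -> J v -> exists w, [/\ J w, u <= w & v <= w]) ->
  (forall y, 0 <= y -> (forall u, J u -> vl_meet y u = 0) -> y = 0) ->
  forall U, nbhs0 U ->
    exists2 u, J u & forall x, vl_meet (vl_abs x) u = 0 -> U x.
Proof.
move=> [u0 Ju0] J0 Jdir Jdense U U0.
have baseT := solid_nbhs_base tau_hls.
pose N (V : set X) u : set X := [set x | V (vl_meet (vl_abs x) u)].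
pose B := [set A | exists V u, [/\ solid V, nbhs0 V, J u & A = N V u]].
have meet_abs x u : J u -> vl_abs (vl_meet (vl_abs x) u) = vl_meet (vl_abs x) u.
  by move=> /J0 u0'; rewrite vl_ge0_abs// vl_meet_ge0// vl_abs_ge0.
have baseB : solid_base B.
  split.
  - by exists (N setT u0), setT, u0; split => //; exact: filterT.
  - move=> _ [V [u [sV _ Ju ->]]] x y /= Vy xy.
    apply: (solid_le sV Vy); first by rewrite vl_meet_ge0 ?vl_abs_ge0// J0.
    by rewrite vl_leI2.
  - move=> _ _ [V [u [sV V0 Ju ->]]] [V' [u' [sV' V0' Ju' ->]]].
    have [w [Jw uw u'w]] := Jdir _ _ Ju Ju'.
    have [W [sW W0 WVV']] := nbhs0_solid tau_hls (filterI V0 V0').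
    exists (N W w); first by exists W, w.
    move=> x /WVV'[Vx V'x]; split.
      apply: (solid_le sV Vx); last by rewrite vl_leI2.
      by rewrite vl_meet_ge0 ?vl_abs_ge0// J0.
    apply: (solid_le sV' V'x); last by rewrite vl_leI2.
    by rewrite vl_meet_ge0 ?vl_abs_ge0// J0.
  - move=> _ [V [u [sV V0 Ju ->]]].
    have [W [sW W0 WV]] := nbhs0_half tau_hls V0.
    exists (N W u); first by exists W, u.
    move=> x y Wx Wy; apply: (solid_le sV (WV _ _ Wx Wy)).
      by rewrite vl_meet_ge0 ?vl_abs_ge0// J0.
    apply: le_trans (vl_leI2 (vl_absD x y) (lexx u)) _.
    by rewrite vl_meetD_le ?vl_abs_ge0// J0.
  - move=> _ x [V [u [sV V0 Ju ->]]].
    have [n Vn] := nbhs0_absorb tau_hls x V0; exists n.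
    by apply: (sV _ _ Vn); rewrite meet_abs// vl_leIl.
  - move=> x Bx; apply: vl_abs_eq0.
    rewrite (Jdense (vl_abs x)) ?vl_abs_ge0// => u Ju.
    apply: (nbhs0_separate tau_hls) => V /(nbhs0_solid tau_hls)[W [sW W0 WV]].
    by apply/WV/(Bx (N W u)); exists W, u.
have B0 : B `<=` nbhs0.
  move=> _ [V [u [sV V0 Ju ->]]]; apply: filterS V0 => x Vx.
  by apply: (sV _ _ Vx); rewrite meet_abs// vl_leIl.
have [_ [V [u [sV V0 Ju ->]]] NU] := minimal_nbhs_base baseB B0 U0.
exists u => // x xu; apply: NU => /=; rewrite /N/= xu.
exact: (@nbhs_singleton T).
Qed.

End Minimal.

(** * Minimal topologies have the Lebesgue property *)

Section Lebesgue.
Context {R : realType} {X : vectorLatticeType R}.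
Variable tau : Topological X.
Hypothesis tau_min : minimal_topology tau.
Implicit Types (x y z u v w : X) (U V W J D : set X).

Local Notation T := (topo_space tau).
Local Notation nbhs0 := (nbhs ((0 : X) : T)).

Let tau_hls : hausdorff_locally_solid tau := tau_min.1.

(** Fix u in D and a small positive multiple v of u.  The positive elements
    disjoint from (b - v)^+ for some b in D form a directed set J.  It contains
    every (v - b)^+, and these increase to v as b decreases to 0; so what is
    disjoint from J is disjoint from u, hence belongs to J itself and is 0.
    By minimal_disj some (b - v)^+ is close to 0, and then so is
    b <= (b - v)^+ + v. *)
Lemma minimal_lebesgue D : D !=set0 -> (forall d, D d -> 0 <= d) ->
  (forall b c, D b -> D c -> exists d, [/\ D d, d <= b & d <= c]) ->
  infimums D 0 -> forall U, nbhs0 U -> exists2 d, D d & U d.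
Proof.
move=> [u Du] D0 Ddir [_ infD] U1 U10.
have [U [sU U0 UU1]] := nbhs0_solid tau_hls U10.
have [V [sV V0 VU]] := nbhs0_half tau_hls U0.
have [n Vn] := nbhs0_absorb tau_hls u V0.
set v := _ *: u in Vn.
have v0 : 0 <= v by rewrite vl_scale_ge0 ?D0// invr_ge0.
have uv : u = v *+ n.+1.
  by rewrite -(scaler_nat n.+1 v) scalerA mulfV ?scale1r ?pnatr_eq0.
pose J := [set w | 0 <= w /\ exists2 b, D b & vl_meet w (vl_pos (b - v)) = 0].
have [||||w [w0 [b Db wb]] wV] := minimal_disj tau_min (J := J) _ _ _ _ V0.
- exists 0; split => //; exists u => //.
  by rewrite vl_meet_idl// vl_pos_ge0.
- by move=> w [].
- move=> w w' [w0 [b Db wb]] [w0' [b' Db' wb']].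
  have [d [Dd db db']] := Ddir _ _ Db Db'.
  have mono c : d <= c -> vl_pos (d - v) <= vl_pos (c - v).
    by move=> dc; apply: vl_leU2; rewrite // vl_leD2.
  exists (w + w'); split; rewrite ?vl_lerDl ?vl_lerDr//.
  split; first exact: vl_addr_ge0.
  exists d => //; apply/le_anti; rewrite vl_meet_ge0 ?vl_addr_ge0 ?vl_pos_ge0//.
  rewrite andbT (le_trans (vl_meetD_le _ _ _)) ?vl_pos_ge0//.
  rewrite -[0 in X in _ <= X]addr0 -{1}wb -wb'.
  by rewrite vl_leD// vl_leI2// mono.
- move=> y y0 yJ.
  have yv : vl_meet y v = 0.
    apply/le_anti; rewrite vl_meet_ge0// andbT; apply: infD => d Dd.
    have ydisj : vl_meet (vl_meet y v) (vl_pos (v - d)) = 0.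
      apply: (@vl_disjS _ _ _ y _ (vl_pos (v - d))); rewrite ?vl_pos_ge0//.
      - exact: vl_meet_ge0.
      - exact: vl_leIl.
      apply: yJ; split; first exact: vl_pos_ge0.
      by exists d => //; rewrite -[d - v]opprB vl_pos_disj.
    have : vl_meet y v + vl_pos (v - d) <= v.
      rewrite -vl_disj_join// vl_leUx vl_leIr vl_pos_le//.
      by rewrite vl_lerBl// D0.
    rewrite -vl_leBrr vl_posBmeet opprB addrC subrK => /le_trans; apply.
    exact: vl_leIr.
  (* Being disjoint from u, y is disjoint from (u - v)^+ and belongs to J. *)
  have yu : vl_meet y u = 0.
    by rewrite vl_meetC uv; apply: vl_disj_mulrn => //; rewrite vl_meetC.
  have Jy : J y.
    split => //; exists u => //.
    apply: (vl_disjS y0 (vl_pos_ge0 _) (lexx y) _ yu).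
    by rewrite vl_pos_le ?D0// vl_lerBl.
  by have := yJ _ Jy; rewrite vl_meet_idl.
exists b => //; apply: UU1.
apply: (sU _ (vl_pos (b - v) + v)).
  apply: VU => //; apply: wV.
  by rewrite vl_ge0_abs ?vl_pos_ge0// vl_meetC.
rewrite (vl_ge0_abs (D0 _ Db)) vl_ge0_abs ?vl_addr_ge0 ?vl_pos_ge0//.
by rewrite -vl_leBlr vl_le_pos.
Qed.

End Lebesgue.

(** * Consequences of metrizability *)

Section MetrizableImplies.
Context {R : realType} {X : vectorLatticeType R}.
Variable tau : Topological X.
Hypothesis tau_min : minimal_topology tau.
Hypothesis tau_metr : metrizable R tau.
Implicit Types (x y z u v w : X) (U V W J D : set X).

Local Notation T := (topo_space tau).
Local Notation nbhs0 := (nbhs ((0 : X) : T)).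

Let tau_hls : hausdorff_locally_solid tau := tau_min.1.

Lemma metrizable_nbhs0 : exists W : nat -> set X,
  (forall n, nbhs0 (W n)) /\ forall U, nbhs0 U -> exists n, W n `<=` U.
Proof.
have [d opE] := tau_metr; pose M : metricType R := Metric.Pack d.
have nbhsM U : nbhs ((0 : X) : M) U <-> nbhs0 U.
  by rewrite (@nbhsE M) (@nbhsE T) /open_nbhs -opE.
exists (fun n => @ball R M (0 : X) n.+1%:R^-1); split.
  by move=> n; apply/nbhsM; apply: nbhsx_ballx; rewrite invr_gt0.
move=> U /nbhsM/nbhs_ballP[e /= e0 eU].
exists (Num.truncn e^-1) => x Wx; apply: eU; apply: (@le_ball R M) Wx.
by rewrite ltW// invf_plt ?posrE// truncnS_gt.
Qed.

Let joins (a : X) (l : seq X) : X := foldr vl_join a l.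

Let le_joins a l x : x \in a :: l -> x <= joins a l.
Proof.
rewrite inE => /predU1P[->|]; elim: l => [|b l IH]//=.
  by rewrite (le_trans IH)// vl_leUr.
rewrite inE => /predU1P[->|/IH xl]; first exact: vl_leUl.
by rewrite (le_trans xl)// vl_leUr.
Qed.

Let joins_le a l z : (forall x, x \in a :: l -> x <= z) -> joins a l <= z.
Proof.
elim: l => [|b l IH] lz /=; first by apply: lz; rewrite mem_head.
rewrite vl_leUx lz ?inE ?eqxx ?orbT//= IH// => x; rewrite inE => xl.
by apply: lz; rewrite !inE; case/orP: xl => ->; rewrite ?orbT.
Qed.

(** The differences s - sup F, for F finite in A, decrease to 0.  By the
    Lebesgue property some F_n brings the difference into the n-th set of a
    countable base at zero; the union of the F_n then has supremum s.  The lists l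
    are always completed by a fixed element a of A, so that no F is empty. *)
Lemma metrizable_countable_sup : countable_sup_property X.
Proof.
move=> A s [a Aa] [sA slub].
have [W [W0 Wbase]] := metrizable_nbhs0.
pose inA (l : seq X) := forall x, x \in l -> A x.
have inA_cons l : inA l -> inA (a :: l).
  by move=> lA x; rewrite inE => /predU1P[->//|/lA].
pose D : set X := [set s - joins a l | l in inA].
have js l : inA l -> joins a l <= s.
  by move=> /inA_cons lA; apply: joins_le => x /lA /sA.
have : forall n, exists l, inA l /\ W n (s - joins a l).
  move=> n; suff [_ [l lA <-] Wl] : exists2 d, D d & W n d by exists l.
  apply: (minimal_lebesgue tau_min (D := D)) (W0 n).
  - by exists (s - joins a [::]), [::].
  - by move=> _ [l lA <-]; rewrite vl_subr_ge0 js.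
  - move=> _ _ [l lA <-] [l' lA' <-]; exists (s - joins a (l ++ l')); split.
    + exists (l ++ l') => // x; rewrite mem_cat.
      by move=> /orP[/lA|/lA'].
    + rewrite ![s - _]addrC vl_leD2 vl_leN2; apply: joins_le => x xl.
      by apply: le_joins; move: xl; rewrite !inE mem_cat => /orP[]->; rewrite ?orbT.
    + rewrite ![s - _]addrC vl_leD2 vl_leN2; apply: joins_le => x xl.
      by apply: le_joins; move: xl; rewrite !inE mem_cat => /orP[]->; rewrite ?orbT.
  - split; first by move=> _ [l lA <-]; rewrite vl_subr_ge0 js.
    move=> z zD; have : s <= s - z.
      apply: slub => x Ax; rewrite vl_leBrr addrC -vl_leBrr.
      have xA : inA [:: x] by move=> y; rewrite inE => /eqP ->.
      apply: le_trans (zD _ (ex_intro2 _ _ [:: x] xA erefl)) _.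
      rewrite ![s - _]addrC vl_leD2 vl_leN2; apply: le_joins.
      by rewrite !inE eqxx orbT.
    by rewrite vl_leBrr addrC -vl_leBrr subrr.
move=> /choice[l lP].
exists (\bigcup_n [set` a :: l n]); split.
- by move=> x [n _ /= xl]; apply: (inA_cons (l n)) => //; have [] := lP n.
- apply: bigcup_countable => // n _; apply: finite_set_countable.
  exact: finite_seq.
- split.
    move=> x [n _ /= xl]; apply: sA; apply: (inA_cons (l n)) => //.
    by have [] := lP n.
  move=> b bub; suff E : s - vl_meet b s = 0.
    by rewrite -(subrK (vl_meet b s) s) E add0r vl_leIl.
  apply: (nbhs0_separate tau_hls) => U /(nbhs0_solid tau_hls)[V [sV V0 VU]].
  have [n WV] := Wbase _ V0; have [lA Wl] := lP n.
  apply/VU/(sV _ _ (WV _ Wl)).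
  rewrite !vl_ge0_abs ?vl_subr_ge0 ?vl_leIr ?js//.
  rewrite ![s - _]addrC vl_leD2 vl_leN2 vl_lexI js// andbT.
  by apply: joins_le => x xl; apply: bub; exists n.
Qed.

(** Unboundedness yields for the n-th set of a countable base at zero a u_n whose
    disjoint complement it contains.  Only 0 is disjoint from all the u_n, and in
    an Archimedean vector lattice a band with trivial disjoint complement is
    everything. *)
Lemma metrizable_countable_order_basis :
  archimedean X -> countable_order_basis X.
Proof.
move=> arch; have [W [W0 Wbase]] := metrizable_nbhs0.
have : forall n, exists u, 0 <= u /\
    forall x, vl_meet (vl_abs x) u = 0 -> W n x.
  move=> n.
  suff [u u0 uW] : exists2 u, [set u : X | 0 <= u] u &
      forall x, vl_meet (vl_abs x) u = 0 -> W n x by exists u.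
  apply: (minimal_disj tau_min) (W0 n) => //.
  - by exists 0 => /=.
  - move=> u v /= u0 v0; exists (u + v).
    by rewrite vl_addr_ge0// vl_lerDl// vl_lerDr.
  - by move=> y y0 /(_ y y0); rewrite vl_meet_idl.
move=> /choice[u uP]; exists (range u).
  exact: card_image_le.
apply/seteqP; split => // x _ M /= [[idM supM] uM].
have dM : forall c, dcompl M c -> c = 0.
  move=> c cM; apply: (nbhs0_separate tau_hls) => U /Wbase[n]; apply.
  have [u0 uW] := uP n; apply: uW.
  by rewrite -(vl_ge0_abs u0); apply: cM; apply: uM; exists n.
have absM : M (vl_abs x).
  apply: supM (ideal_sup_approx arch idM (vl_abs_ge0 x) _).
    by move=> y [].
  by move=> c /dM ->; rewrite vl_abs0 vl_meetC vl_meet_idl ?vl_abs_ge0.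
by case: idM => _ _ _; apply; [exact: absM|rewrite vl_absid].
Qed.

End MetrizableImplies.

(** * Normal sequences and the converse *)

Section NormalSequences.
Context {R : realType} {X : vectorLatticeType R}.
Variable tau : Topological X.
Hypothesis X_arch : archimedean X.
Hypothesis tau_min : minimal_topology tau.
Implicit Types (x y z : X) (U : set X) (V W : nat -> set X).

Local Notation T := (topo_space tau).
Local Notation nbhs0 := (nbhs ((0 : X) : T)).

Let tau_hls : hausdorff_locally_solid tau := tau_min.1.

Definition normal_seq V : Prop := forall n,
  [/\ solid (V n), nbhs0 (V n) & forall x y, V n.+1 x -> V n.+1 y -> V n (x + y)].

Definition kernel V : set X := \bigcap_n V n.

Lemma nbhs0_center U : nbhs0 U -> U 0.
Proof. exact: (@nbhs_singleton T). Qed.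

Lemma normal_seq_decr V m n : normal_seq V -> (m <= n)%N -> V n `<=` V m.
Proof.
move=> nV /subnK <-; elim: (n - m)%N => [//|k IH] x Vx; apply: IH.
have [_ _ Vh] := nV (k + m)%N; rewrite -[x]addr0; apply: Vh => //.
have [_ V0 _] := nV (k + m).+1; exact: nbhs0_center.
Qed.

Lemma normal_seq_exists U : nbhs0 U -> exists2 V, normal_seq V & V 0%N `<=` U.
Proof.
move=> U0.
have /choice[h hP] : forall A : set X, exists B : set X, nbhs0 A ->
    [/\ solid B, nbhs0 B & forall x y, B x -> B y -> A (x + y)].
  move=> A; have [A0|nA0] := pselect (nbhs0 A); last by exists A.
  by have [B BA] := nbhs0_half tau_hls A0; exists B.
have it0 n : nbhs0 (iter n h U) by elim: n => //= n /hP[].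
exists (fun n => iter n.+1 h U).
  move=> n; have [sV V0 _] := hP _ (it0 n); split => //.
  by have [_ _] := hP _ (it0 n.+1).
move=> x hx; have [_ h0 hU] := hP _ U0.
by rewrite -[x]addr0; apply: hU => //; exact: nbhs0_center.
Qed.

Lemma kernel_ideal V : normal_seq V -> order_ideal (kernel V).
Proof.
move=> nV.
apply: solid_add_ideal.
- by move=> n _; have [_ V0 _] := nV n; exact: nbhs0_center.
- move=> x y Kx Ky n _.
  by have [_ _] := nV n; apply; [exact: Kx|exact: Ky].
- by move=> x y Ky xy n _; have [sV _ _] := nV n; apply: sV xy; exact: Ky.
Qed.

(** Kernels are bands: an element y >= 0 of the double disjoint complement is the
    supremum of the z in the kernel below it, so by the Lebesgue property y - z
    lies in a given zero neighbourhood for some such z. *)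
Lemma kernel_dcompl2 V : normal_seq V ->
  dcompl (dcompl (kernel V)) `<=` kernel V.
Proof.
move=> nV x xK n _; have idK := kernel_ideal nV.
have [sV V0 Vhalf] := nV n.
apply: (sV _ (vl_abs x)); last by rewrite vl_absid.
have [K0 addK _ _] := idK.
set y := vl_abs x; have y0 : 0 <= y by exact: vl_abs_ge0.
have [ysub ylub] :=
  ideal_sup_approx X_arch idK y0 (ideal_abs (dcompl_ideal _) xK).
pose D : set X := [set y - z | z in [set z | [/\ kernel V z, 0 <= z & z <= y]]].
have [_ V1 _] := nV n.+1.
have [||||_ [z [Kz z0 zy] <-] Vyz] := minimal_lebesgue tau_min (D := D) _ _ _ _ V1.
- by exists (y - 0), 0.
- by move=> _ [z [_ _ zy] <-]; rewrite vl_subr_ge0.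
- move=> _ _ [z [Kz z0 zy] <-] [z' [Kz' z0' zy'] <-].
  exists (y - vl_join z z'); split.
  + exists (vl_join z z') => //; split.
    * apply: (ideal_le idK (addK _ _ Kz Kz')).
        by rewrite (le_trans z0)// vl_leUl.
      by rewrite vl_leUx vl_lerDl// vl_lerDr.
    * by rewrite (le_trans z0)// vl_leUl.
    * by rewrite vl_leUx zy.
  + by rewrite ![y - _]addrC vl_leD2 vl_leN2 vl_leUl.
  + by rewrite ![y - _]addrC vl_leD2 vl_leN2 vl_leUr.
- split; first by move=> _ [z [_ _ zy] <-]; rewrite vl_subr_ge0.
  move=> w wD; have : y <= y - w.
    apply: ylub => z Kz; rewrite vl_leBrr addrC -vl_leBrr.
    by apply: wD; exists z.
  by rewrite vl_leBrr addrC -vl_leBrr subrr.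
by rewrite -(subrK z y); apply: Vhalf => //; exact: Kz.
Qed.

(** The carrier of the topology in the sense of Aliprantis and Burkinshaw. *)
Definition carrier : set X :=
  [set x | exists2 V, normal_seq V & dcompl (kernel V) x].

(** The diagonal intersection of V_0, ..., V_n at rank n keeps each W_n a finite
    intersection, hence a zero neighbourhood. *)
Lemma normal_seq_bigcap (V : nat -> nat -> set X) :
  (forall k, normal_seq (V k)) ->
  exists2 W, normal_seq W & forall k, kernel W `<=` kernel (V k).
Proof.
move=> nV; pose W n := [set x | forall k, (k <= n)%N -> V k n x].
exists W.
  move=> n; split.
  - move=> x y Wy xy k kn; have [sV _ _] := nV k n.
    by apply: sV xy; exact: Wy.
  - suff : forall m, nbhs0 [set x | forall k, (k < m)%N -> V k n x].
      by move=> /(_ n.+1); apply: filterS => x Vx k kn; exact: Vx.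
    elim=> [|m IH]; first by apply: filterS filterT => x _ k; rewrite ltn0.
    have [_ Vm0 _] := nV m n; apply: filterS (filterI IH Vm0) => x [Vx Vmx] k.
    by rewrite ltnS leq_eqVlt => /predU1P[->//|/Vx].
  - move=> x y Wx Wy k kn; have [_ _] := nV k n; apply.
      by apply: Wx; rewrite leqW.
    by apply: Wy; rewrite leqW.
move=> k x Wx n _; apply: (normal_seq_decr (nV k) (leq_maxl n k)).
by apply: Wx => //; exact: leq_maxr.
Qed.

Lemma carrier_ideal : order_ideal carrier.
Proof.
apply: solid_add_ideal.
- have [V nV _] := normal_seq_exists (filterT : nbhs0 setT).
  by exists V => //; have [] := dcompl_ideal (kernel V).
- move=> x y [V nV Vx] [W nW Wy].
  have [Z nZ ZVW] :=
    @normal_seq_bigcap (fun k => if k is 0 then V else W)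
      (fun k => match k with 0 => nV | _.+1 => nW end).
  exists Z => //; have [_ + _ _] := dcompl_ideal (kernel Z); apply.
    exact: dcomplS (ZVW 0%N) _ Vx.
  exact: dcomplS (ZVW 1%N) _ Wy.
- move=> x y [V nV Vy] xy; exists V => //.
  by have [_ _ _] := dcompl_ideal (kernel V); apply; first exact: Vy.
Qed.

(** An x disjoint from the carrier lies in the double disjoint complement of every
    kernel, that is, in every kernel; and the kernels intersect in 0. *)
Lemma carrier_order_dense x : dcompl carrier x -> x = 0.
Proof.
move=> xI; apply: (nbhs0_separate tau_hls) => U /normal_seq_exists[V nV VU].
apply: VU; suff : kernel V x by exact.
by apply: (kernel_dcompl2 nV) => c Kc; apply: xI; exists V.
Qed.

Lemma carrier_countable (C : set X) : countable C -> C `<=` carrier ->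
  exists2 W, normal_seq W & C `<=` dcompl (kernel W).
Proof.
move=> /pfcard_geP[->|/unsquash f] CI.
  have [V nV _] := normal_seq_exists (filterT : nbhs0 setT).
  by exists V => // x.
have /choice[V VP] : forall k, exists V, normal_seq V /\ dcompl (kernel V) (f k).
  move=> k; have /CI[V nV Vf] : C (f k) by exact: funS.
  by exists V.
have [W nW WV] := normal_seq_bigcap (fun k => (VP k).1).
exists W => // x /(@surj _ _ _ _ f)[k _ <-].
exact: dcomplS (WV k) _ (VP k).2.
Qed.

(** Each |e|, for e in a countable order basis, is the supremum of the elements
    of the carrier below it, hence of countably many of them.  All these elements
    are disjoint from the kernel of a single normal sequence W; so is the band
    they generate, which is X. *)
Lemma separating_normal_seq :
  countable_sup_property X -> countable_order_basis X ->
  exists2 W, normal_seq W & kernel W `<=` [set 0].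
Proof.
move=> csp [A cA bandA].
have /choice[F FP] : forall e, exists F : set X,
    [/\ F `<=` carrier, countable F & supremums F (vl_abs e)].
  move=> e; have [K0 _ _ _] := carrier_ideal.
  have [||F [FI cF Fe]] := csp [set y | [/\ carrier y, 0 <= y & y <= vl_abs e]]
    (vl_abs e).
  - by exists 0; split => //; exact: vl_abs_ge0.
  - apply: (ideal_sup_approx X_arch carrier_ideal (vl_abs_ge0 e)) => c.
    move=> /carrier_order_dense ->.
    by rewrite vl_abs0 vl_meetC vl_meet_idl ?vl_abs_ge0.
  by exists F; split => // x /FI[].
have [W nW FW] : exists2 W, normal_seq W &
    \bigcup_(e in A) F e `<=` dcompl (kernel W).
  apply: carrier_countable.
    by apply: bigcup_countable => // e _; have [] := FP e.
  by move=> x [e _ Fx]; have [+ _ _] := FP e; apply.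
exists W => // x Kx; apply: (dcompl_disj Kx).
suff /(_ x) : smallest (@band R X) A `<=` dcompl (kernel W) by rewrite bandA; apply.
apply: smallest_sub; first exact: dcompl_band.
move=> e Ae; have [idW supW] := dcompl_band (kernel W).
have [_ _ _ sW] := idW; have [_ _ Fe] := FP e.
apply: (sW _ (vl_abs e)); last by rewrite vl_absid.
by apply: supW Fe => y Fy; apply: FW; exists e.
Qed.

Lemma normal_seq_base W : normal_seq W -> kernel W `<=` [set 0] ->
  solid_base (range W).
Proof.
move=> nW W0; split.
- by exists (W 0%N), 0%N.
- by move=> _ [n _ <-]; have [] := nW n.
- move=> _ _ [m _ <-] [n _ <-]; exists (W (maxn m n)); first by exists (maxn m n).
  by move=> x Wx; split; apply: normal_seq_decr Wx => //; rewrite ?leq_maxl ?leq_maxr.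
- move=> _ [n _ <-]; exists (W n.+1); first by exists n.+1.
  by have [] := nW n.
- by move=> _ x [n _ <-]; have [_ Wn _] := nW n; exact: (nbhs0_absorb tau_hls).
- by move=> x Wx; apply: W0 => n _; apply: Wx; exists n.
Qed.

Lemma countable_implies_metrizable :
  countable_sup_property X -> countable_order_basis X -> metrizable R tau.
Proof.
move=> csp cob; have [W nW W0] := separating_normal_seq csp cob.
have baseW := normal_seq_base nW W0.
have opE : @open (base_space baseW) = @open T.
  apply: (minimal_open_base tau_min) => _ [n _ <-].
  by have [] := nW n.
have [|d dE] := @countable_uniformity_metrizable R (base_space baseW)
  (base_hausdorff (baseB := baseW)).
  apply/countable_uniformityP.
  exists (fun n => [set p | W n ((p.2 : X) - (p.1 : X))]).
    by move=> A; rewrite base_entourageE => -[_ [n _ <-] WA]; exists n.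
  by move=> n; rewrite base_entourageE; exists (W n) => //; exists n.
by exists d; rewrite dE -opE.
Qed.

End NormalSequences.

Theorem theorem4p9 (R : realType) (X : vectorLatticeType R)
    (tau : Topological X) :
  archimedean X -> minimal_topology tau ->
  (metrizable R tau <-> countable_sup_property X /\ countable_order_basis X).
Proof.
move=> arch tau_min; split=> [metr|[csp cob]].
  split; first exact: (metrizable_countable_sup tau_min metr).
  exact: (metrizable_countable_order_basis tau_min metr arch).
exact: (countable_implies_metrizable arch tau_min csp cob).
Qed.
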